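(* Let $n$ be an integer. If $(x,y)$ is a point with integer coordinates on the curve $y^2=5x^2(x+3)^2+4(-1)^n$, then: if $n$ is even, $(x,y)\in\{(-3,\pm2),(0,\pm2)\}$; if $n$ is odd, $(x,y)\in\{(-2,\pm4),(-1,\pm4)\}$. *)

(* Defs.v *)
From mathcomp Require Import all_boot all_order all_algebra.

Set Implicit Arguments.
Unset Strict Implicit.
Unset Printing Implicit Defensive.

(* Main.v *)
Require Import Defs.
From mathcomp Require Import all_boot all_order all_algebra.
From mathcomp Require Import zify ring.

Set Implicit Arguments.
Unset Strict Implicit.
Unset Printing Implicit Defensive.

(** Since [x (x + 3)] is even, so is [y]; writing [x (x + 3) = 2 M] and [y = 2 Y]
    gives [Y^2 - 5 M^2 = 1] or [-1], so that [(Y, M) = (Y_j, M_j)] up to signs, with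
    [Y_j + M_j sqrt 5 = (2 + sqrt 5)^j], while [8 M + 9 = (2 x + 3)^2] is a square.
    The claim is that [8 M_j + 9] is not a square for [j > 0]; the remaining case
    [M <= 0] means [-3 <= x <= 0].

    Reduction modulo 3, 13, 23, 29, 49 and 83 shows that [j] is a multiple of 56.
    Write [j = 2 l t] with [t] odd and [l] even, and let [N = Y_{2 l}], which is
    [Y_l^2 + 5 M_l^2].  As [(2 + sqrt 5)^(4 l) = -1] modulo [N], we get
    [M_j = M_{2 l}] or [- M_{2 l}] according to [t] modulo 4, hence
    [8 M_j + 9 = 2 Y_l (9 Y_l + 8 M_l)] or [2 Y_l (9 Y_l - 8 M_l)] modulo [N].
    Quadratic reciprocity for the Jacobi symbol shows that this can be a square only if
    [9 Y_l + 8 M_l], resp. [9 Y_l - 8 M_l], has symbol [1] modulo [469 = 7 * 67].  That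
    symbol is periodic in [l], and one of the choices [l = 2^e], [l = 7 * 2^e] always
    gives [-1].  *)

(** * The Jacobi symbol through Gauss's lemma, and quadratic reciprocity *)

Definition gauss_bit (a n k : nat) : bool := n./2 < (a * k) %% n.
Definition gauss_abs (a n k : nat) : nat :=
  if gauss_bit a n k then n - (a * k) %% n else (a * k) %% n.
(* Gauss's lemma taken as the definition of the Jacobi symbol (a/n), for n odd
   and coprime to a; [true] stands for the value -1. *)
Definition gauss (a n : nat) : bool :=
  odd (count (gauss_bit a n) (iota 1 n./2)).

Lemma gauss_modl a n : gauss (a %% n) n = gauss a n.
Proof. by rewrite /gauss; congr odd; apply: eq_count => k; rewrite /gauss_bit modnMml. Qed.

Lemma gauss_eqmod a b n : a = b %[mod n] -> gauss a n = gauss b n.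
Proof. by move=> e; rewrite -gauss_modl e gauss_modl. Qed.

(* [a * k] is congruent to [gauss_abs a n k] up to the sign [gauss_bit a n k];
   both sides are kept additive to avoid truncated subtraction. *)
Lemma gauss_absP a n k : odd n ->
  exists q, a * k + (if gauss_bit a n k then gauss_abs a n k else 0)
          = q * n + (if gauss_bit a n k then 0 else gauss_abs a n k).
Proof.
move=> n_odd; have n0 : 0 < n by case: n n_odd.
rewrite /gauss_abs; have := divn_eq (a * k) n; have := ltn_pmod (a * k) n0.
case: gauss_bit => lt e.
  by exists ((a * k) %/ n).+1; lia.
by exists ((a * k) %/ n); lia.
Qed.

Lemma half_range_modn_gt0 a n k : coprime a n -> 0 < k <= n./2 -> 0 < (a * k) %% n.
Proof.
move=> co /andP[k0 kh]; rewrite lt0n; apply/negP; rewrite -/(n %| a * k).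
rewrite Gauss_dvdr; last by rewrite coprime_sym.
by move=> /(dvdn_leq k0); lia.
Qed.

Lemma gauss_abs_range a n k : odd n -> coprime a n -> 0 < k <= n./2 ->
  0 < gauss_abs a n k <= n./2.
Proof.
move=> n_odd co kP; have r0 := half_range_modn_gt0 co kP.
have n0 : 0 < n by case: n n_odd {co kP r0}.
have := ltn_pmod (a * k) n0.
by rewrite /gauss_abs /gauss_bit; case: ifP => ?; lia.
Qed.

(** If [i] and [j] have equal absolute residues, then [n] divides [a * (i - j)] when the signs agree
    and [a * (i + j)] when they differ; the second is impossible since [0 < i + j < n]. *)
Lemma gauss_abs_inj a n : odd n -> coprime a n ->
  {in iota 1 n./2 &, injective (gauss_abs a n)}.
Proof.
move=> n_odd co i j; rewrite !mem_iota => iP jP e.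
have co' : coprime n a by rewrite coprime_sym.
have [qi ei] := gauss_absP a i n_odd; have [qj ej] := gauss_absP a j n_odd.
have [/eqP bb|bb] := boolP (gauss_bit a n i == gauss_bit a n j).
  have {}ei : a * i = a * j %[mod n].
    apply/eqP; rewrite -(eqn_modDr (if gauss_bit a n i then gauss_abs a n i else 0)).
    by rewrite ei e bb ej !modnMDl.
  wlog le_ij : i j iP jP e ei {ej qi qj bb} / i <= j.
    by case: (leqP i j) => [le|/ltnW le] H; [apply: H|symmetry; apply: H].
  move/esym/eqP: ei; rewrite eqn_mod_dvd ?leq_mul2l ?le_ij ?orbT // -mulnBr Gauss_dvdr //.
  by have [d0|d0 /(dvdn_leq d0)] := posnP (j - i); lia.
have: n %| a * (i + j).
  have [q ->] : exists q, a * (i + j) = q * n; last by rewrite dvdn_mull.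
  exists (qi + qj); rewrite mulnDl mulnDr; move: bb ei ej; rewrite e.
  by case: (gauss_bit a n i); case: (gauss_bit a n j) => //= _; lia.
by rewrite Gauss_dvdr // => /dvdn_leq; lia.
Qed.

Lemma gauss_abs_perm a n : odd n -> coprime a n ->
  perm_eq [seq gauss_abs a n k | k <- iota 1 n./2] (iota 1 n./2).
Proof.
move=> n_odd co.
have u : uniq [seq gauss_abs a n k | k <- iota 1 n./2].
  by rewrite map_inj_in_uniq ?iota_uniq //; apply: gauss_abs_inj.
apply: uniq_perm => //; first exact: iota_uniq.
have sub : {subset [seq gauss_abs a n k | k <- iota 1 n./2] <= iota 1 n./2}.
  move=> _ /mapP[k + ->]; rewrite !mem_iota => kP.
  by have := @gauss_abs_range a n k n_odd co; lia.
by have [] := uniq_min_size u sub; rewrite ?size_map.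
Qed.

Lemma gaussE a n : gauss a n = odd (\sum_(k <- iota 1 n./2) gauss_bit a n k).
Proof. by rewrite /gauss -sum1_count big_mkcond; congr odd; apply: eq_bigr => k _; case: gauss_bit. Qed.

Lemma odd_sum (I : eqType) (s : seq I) (F G : I -> nat) :
  {in s, forall i, odd (F i) = odd (G i)} ->
  odd (\sum_(i <- s) F i) = odd (\sum_(i <- s) G i).
Proof.
elim: s => [|i s IH] e; rewrite ?big_nil // !big_cons !oddD e ?mem_head // IH //.
by move=> j js; apply: e; rewrite in_cons js orbT.
Qed.

(** As [k] runs over the half range, so does the absolute residue of [b * k]; the sign of
    [a * b * k] is the product of the sign of [b * k] and that of [a] times this residue. *)
Lemma gaussM a b n : odd n -> coprime a n -> coprime b n ->
  gauss (a * b) n = gauss a n (+) gauss b n.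
Proof.
move=> n_odd coa cob.
rewrite !gaussE -[in X in odd X (+) _](perm_big _ (gauss_abs_perm n_odd cob)) /= big_map.
rewrite -oddD -big_split /=; apply: odd_sum => k; rewrite mem_iota => kP.
have {}kP : 0 < k <= n./2 by lia.
have n0 : 0 < n by case: n n_odd {coa cob kP}.
have coab : coprime (a * b) n by rewrite coprimeMl coa.
have r0 := half_range_modn_gt0 coab kP.
have s0 := half_range_modn_gt0 coa (gauss_abs_range n_odd cob kP).
have [q] := gauss_absP b k n_odd.
case: (gauss_bit b n k) => e; last first.
  have -> : gauss_bit (a * b) n k = gauss_bit a n (gauss_abs b n k); last by rewrite addn0.
  rewrite /gauss_bit; suff -> : (a * b * k) = a * q * n + a * gauss_abs b n k by rewrite modnMDl.
  by rewrite -!mulnA -mulnDr; congr muln; lia.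
(* When [b * k] has negative sign, the two residues are opposite modulo [n], so exactly one of them
   exceeds [n./2]. *)
have d : (a * b * k) %% n + (a * gauss_abs b n k) %% n = n.
  have: n %| (a * b * k) %% n + (a * gauss_abs b n k) %% n.
    rewrite /dvdn modnDm -mulnA -mulnDr.
    by rewrite (_ : b * k + _ = q * n) 1?mulnA ?modnMl //; lia.
  case/dvdnP=> m; have := ltn_pmod (a * b * k) n0; have := ltn_pmod (a * gauss_abs b n k) n0.
  by case: m => [|[|m]]; lia.
rewrite /gauss_bit oddD.
have -> : (n./2 < (a * b * k) %% n) = ~~ (n./2 < (a * gauss_abs b n k) %% n) by lia.
by case: (_ < _).
Qed.

(* Eisenstein's form of the symbol: reduce [a k = n q + r] modulo 2 and sum over [k]. *)
Lemma gauss_floor a n : odd a -> odd n -> coprime a n ->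
  gauss a n = odd (\sum_(k <- iota 1 n./2) (a * k) %/ n).
Proof.
move=> a_odd n_odd co; rewrite gaussE.
have H : odd (\sum_(k <- iota 1 n./2) k) =
  odd (\sum_(k <- iota 1 n./2) ((a * k) %/ n + gauss_bit a n k + gauss_abs a n k)).
  apply: odd_sum => k _; have := divn_eq (a * k) n.
  have n0 : 0 < n by case: n n_odd {co}.
  have := ltn_pmod (a * k) n0.
  rewrite /gauss_abs; case: gauss_bit => lt /(congr1 odd).
    by rewrite oddM a_odd oddD oddM n_odd andbT /= => ->; rewrite !oddD oddB ?n_odd; [case: (odd _); case: (odd _)|lia].
  by rewrite oddM a_odd oddD oddM n_odd andbT /= => ->; rewrite !oddD addbF.
(* The absolute residues permute the half range, so their sum cancels the sum of the [k]. *)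
move: H; rewrite !big_split /= -(big_map (gauss_abs a n) predT id) /=.
rewrite (perm_big _ (gauss_abs_perm n_odd co)) /= !oddD.
by do 3 case: (odd _).
Qed.

Lemma count_multiples m n x : 0 < n -> \sum_(l <- iota 1 m) (l * n <= x) = minn m (x %/ n).
Proof.
move=> n0; elim: m => [|m IH]; first by rewrite big_nil min0n.
rewrite -(addn1 m) iotaD big_cat /= big_seq1 IH -leq_divRL //; lia.
Qed.

(** Eisenstein's lattice count: the two floor sums count the points of a rectangle with sides [a./2]
    and [n./2] on either side of the diagonal, which by coprimality contains none of them. *)
Lemma gauss_reciprocity a n : odd a -> odd n -> coprime a n ->
  gauss a n (+) gauss n a = odd (a./2 * n./2).
Proof.
move=> a_odd n_odd co; rewrite gauss_floor // [gauss n a]gauss_floor // 1?coprime_sym //.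
rewrite -oddD; congr odd.
have a0 : 0 < a by case: a a_odd {co}.
have n0 : 0 < n by case: n n_odd {co}.
have F b m k : odd b -> 0 < m -> odd m -> k \in iota 1 m./2 ->
  (b * k) %/ m = \sum_(l <- iota 1 b./2) (l * m <= b * k).
  rewrite mem_iota => b_odd m0 m_odd kP; rewrite count_multiples //; apply/esym/minn_idPr.
  rewrite -ltnS ltn_divLR //; nia.
rewrite (eq_big_seq _ (fun k => F a n k a_odd n0 n_odd)) (eq_big_seq _ (fun k => F n a k n_odd a0 a_odd)).
rewrite [X in _ + X]exchange_big /= -big_split /=.
transitivity (\sum_(i <- iota 1 n./2) \sum_(l <- iota 1 a./2) 1); last first.
  by rewrite sum1_size size_iota big_const_seq count_predT size_iota iter_addn_0.
apply: eq_big_seq => k; rewrite mem_iota => kP; rewrite -big_split /=.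
apply: eq_big_seq => l; rewrite mem_iota => lP.
have : l * n != a * k.
  apply/eqP => e; have : n %| a * k by rewrite -e dvdn_mull.
  by rewrite Gauss_dvdr 1?coprime_sym // => /dvdn_leq; lia.
by rewrite [k * a]mulnC [n * l]mulnC; case: ltngtP.
Qed.

(** For [n = 8 q + 1] no [2 k] needs reduction, and the bit is set for the [2 q] values
    [2 q < k <= 4 q]. *)
Lemma gauss2 n : n %% 8 = 1 -> gauss 2 n = false.
Proof.
move=> n8; rewrite gaussE.
have [q en] : exists q, n = 8 * q + 1 by exists (n %/ 8); lia.
have eh : n./2 = 4 * q by lia.
have -> : \sum_(k <- iota 1 n./2) gauss_bit 2 n k = \sum_(k <- iota 1 n./2) (2 * q < k).
  apply: eq_big_seq => k; rewrite mem_iota => kP; rewrite /gauss_bit modn_small; lia.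
have H m c : \sum_(k <- iota 1 m) (c < k) = m - c.
  elim: m => [|m IH]; first by rewrite big_nil.
  by rewrite -(addn1 m) iotaD big_cat /= big_seq1 IH; lia.
by rewrite H eh -mulnBl oddM.
Qed.

(** * Units of norm 1 and -1: the Pell sequence *)

(* [(pell j).1 + (pell j).2 sqrt 5 = (2 + sqrt 5) ^ j] *)
Fixpoint pell j : nat * nat :=
  if j is i.+1 then (2 * (pell i).1 + 5 * (pell i).2, (pell i).1 + 2 * (pell i).2)
  else (1, 0).

Lemma pellD a b :
  pell (a + b) = ((pell a).1 * (pell b).1 + 5 * ((pell a).2 * (pell b).2),
                  (pell a).1 * (pell b).2 + (pell a).2 * (pell b).1).
Proof.
elim: a => [|a IH]; first by case: (pell b) => y m; congr pair => /=; lia.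
by rewrite addSn /= IH /=; congr pair; lia.
Qed.

Lemma pell_norm j :
  if odd j then (pell j).1 * (pell j).1 + 1 = 5 * ((pell j).2 * (pell j).2)
  else (pell j).1 * (pell j).1 = 5 * ((pell j).2 * (pell j).2) + 1.
Proof. by elim: j => [|j] //=; case: (odd j) => /= IH; nia. Qed.

(** Descent on [M]: multiplication by [sqrt 5 - 2], the inverse of [2 + sqrt 5], turns [(Y, M)] into
    the smaller solution [(5 M - 2 Y, Y - 2 M)] of opposite norm. *)
Lemma pell_complete Y M :
  Y * Y = 5 * (M * M) + 1 \/ Y * Y + 1 = 5 * (M * M) -> exists j, pell j = (Y, M).
Proof.
have [m] := ubnP M; elim: m Y M => // m IH Y [|M] leM YM.
  by exists 0; congr pair; nia.
have [||j ej] := IH (5 * M.+1 - 2 * Y) (Y - 2 * M.+1); first by nia.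
  have : 2 * M.+1 <= Y by nia.
  have : 2 * Y <= 5 * M.+1 by nia.
  move: M.+1 YM => X YX le1 le2.
  have [a ea] : exists a, 5 * X = 2 * Y + a by exists (5 * X - 2 * Y); lia.
  have [b eb] : exists b, Y = 2 * X + b by exists (Y - 2 * X); lia.
  have -> : 5 * X - 2 * Y = a by lia.
  have -> : Y - 2 * X = b by lia.
  nia.
by exists j.+1; rewrite /= ej /=; congr pair; nia.
Qed.

Lemma pell_double k : ~~ odd k ->
  pell (k + k) = (2 * ((pell k).1 * (pell k).1) - 1, 2 * ((pell k).1 * (pell k).2)).
Proof. by move=> /negPf k_even; have := pell_norm k; rewrite k_even pellD => N; congr pair; lia. Qed.

(** By [pell_double], [(2 + sqrt 5)^(2 k)] is -1 modulo [(pell k).1]. *)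
Lemma pell_shift a k : ~~ odd k -> (pell k).1 %| (pell (a + 2 * k)).2 + (pell a).2.
Proof.
move=> k_even; rewrite mul2n -addnn pellD pell_double //=.
have N := pell_norm k; rewrite (negPf k_even) in N.
apply/dvdnP; exists (2 * ((pell a).1 * (pell k).2 + (pell a).2 * (pell k).1)).
by case: (pell k) N => y m /=; case: (pell a) => b c /= N; nia.
Qed.

Lemma pell_mul1 k q : ~~ odd k -> (pell (k * (4 * q + 1))).2 = (pell k).2 %[mod (pell k).1].
Proof.
move=> k_even; elim: q => [|q <-]; first by rewrite muln1.
have -> : k * (4 * q.+1 + 1) = k * (4 * q + 1) + 2 * k + 2 * k by lia.
set a := k * (4 * q + 1).
have /dvdnP[u eu] := pell_shift a k_even.
have /dvdnP[v ev] := pell_shift (a + 2 * k) k_even.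
apply/eqP; rewrite -(eqn_modDr (pell (a + 2 * k)).2) ev addnC.
by rewrite addnC eq_sym addnC eu !modnMl.
Qed.

Lemma pell_mul3 k q : ~~ odd k -> (pell k).1 %| (pell (k * (4 * q + 3))).2 + (pell k).2.
Proof.
move=> k_even; have := pell_shift (k * (4 * q + 1)) k_even.
by rewrite /dvdn -modnDmr (pell_mul1 q k_even) modnDmr (_ : _ + 2 * k = k * (4 * q + 3)) //; lia.
Qed.

(** * The reciprocity argument leading to the modulus 469 *)

(* [A] is one of [9 Y + 8 M] and [9 Y - 8 M], and [B] is the other.  The
   hypothesis [square] gives [1 = (2/N)(Y/N)(A/N) = (A/N)], and reciprocity turns
   [(A/N)] into [(64 N/A) = (469 Y^2/A) = (469/A) = (A/469)]. *)
Section ResidueCondition.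
Variables Y M A B z : nat.
Hypotheses (M_even : ~~ odd M) (norm : Y * Y = 5 * (M * M) + 1).
Hypotheses (A_odd : odd A) (coA : coprime A 469).
Let N := 2 * (Y * Y) - 1.
Hypothesis eAB : 469 * (Y * Y) = 64 * N + 5 * (A * B).
Hypothesis square : z * z = 2 * (Y * A) %[mod N].

Lemma gauss_469 : gauss A 469 = false.
Proof.
have N8 : N %% 8 = 1.
  rewrite /N norm -[M]odd_double_half (negPf M_even) add0n -mul2n.
  by move: (M./2) => m; rewrite (_ : _ - 1 = 5 * (m * m) * 8 + 1) ?modnMDl //; lia.
have N_odd : odd N by lia.
have Y_odd : odd Y by have : odd (Y * Y) by [rewrite norm; lia]; rewrite oddM andbb.
have eN : N = Y * Y + 5 * (M * M) by rewrite /N; lia.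
have coY5 : coprime Y (5 * (M * M)).
  have : coprime (Y * Y) (5 * (M * M)) by rewrite norm addn1 coprimeSn.
  by rewrite coprimeMl andbb.
have coYN : coprime Y N by rewrite eN /coprime gcdnMDl.
have coAN : coprime A N.
  rewrite /coprime -dvdn1 -(eqP coA) dvdn_gcd dvdn_gcdl /=.
  have : gcdn A N %| 469 * (Y * Y).
    by rewrite eAB dvdn_add // dvdn_mull // ?dvdn_gcdr // dvdn_mulr // dvdn_gcdl.
  rewrite Gauss_dvdl // coprimeMr andbb.
  by rewrite coprime_sym (coprime_dvdr (dvdn_gcdr A N) coYN).
have co2 x : odd x -> coprime 2 x by move=> ox; rewrite coprime2n.
have coAY : coprime A Y.
  have := dvdn_gcdl A Y; have := dvdn_gcdr A Y.
  rewrite /coprime -dvdn1 -(eqP coYN) dvdn_gcd => -> /= dA.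
  have : gcdn A Y %| 64 * N.
    rewrite -(dvdn_addl (64 * N) (_ : gcdn A Y %| 5 * (A * B))); last first.
      by rewrite dvdn_mull // dvdn_mulr.
    by rewrite -eAB !dvdn_mull // dvdn_gcdr.
  rewrite Gauss_dvdr // coprime_sym -[64]/(2 ^ 6) coprime_pexpl // co2 //.
  by apply: dvdn_odd dA A_odd.
(* As [N] is 1 modulo 4, [(Y/N) = (N/Y) = (5 M^2/Y) = (5/Y) = (Y/5)], and [Y] is 1 or -1 modulo
   5. *)
have gYN : gauss Y N = false.
  have := gauss_reciprocity Y_odd N_odd coYN.
  have -> : odd (Y./2 * N./2) = false by rewrite oddM (_ : odd N./2 = false) ?andbF //; lia.
  have -> : gauss N Y = gauss (5 * (M * M)) Y by apply: gauss_eqmod; rewrite eN modnMDl.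
  move: coY5; rewrite coprime_sym !coprimeMl andbb => /andP[co5 coM].
  rewrite !gaussM // ?coprimeMl ?coM // addbb addbF.
  have := @gauss_reciprocity 5 Y isT Y_odd co5; rewrite mul2n odd_double => e5.
  have -> : gauss 5 Y = gauss Y 5 by case: (gauss 5 Y) e5; case: gauss.
  rewrite -(gauss_modl Y 5).
  have : Y * Y %% 5 = 1 by rewrite norm; lia.
  rewrite -modnMml -modnMmr; have := ltn_pmod Y (isT : 0 < 5).
  by case: (Y %% 5) => [|[|[|[|[|]]]]] //= _ _; rewrite addbF.
have zN : coprime z N.
  have : coprime (z * z) N.
    by rewrite -coprime_modl square coprime_modl !coprimeMl co2 // coYN.
  by rewrite coprimeMl andbb.
have gAN : gauss A N = false.
  have := gauss_eqmod square.
  by rewrite !gaussM ?coprimeMl ?coYN ?co2 // gauss2 // gYN addbb.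
have gNA : gauss N A = false.
  have := gauss_reciprocity A_odd N_odd coAN.
  have -> : odd (A./2 * N./2) = false by rewrite oddM (_ : odd N./2 = false) ?andbF //; lia.
  by rewrite gAN.
have : gauss (469 * (Y * Y)) A = gauss (8 * 8 * N) A.
  by apply: gauss_eqmod; rewrite eAB addnC (_ : 5 * (A * B) = 5 * B * A) ?modnMDl // -mulnA [A * B]mulnC.
have co8 : coprime 8 A by rewrite -[8]/(2 ^ 3) coprime_pexpl // co2.
rewrite !gaussM ?coprimeMl ?co8 ?[coprime _ A]coprime_sym ?coAY // !addbb gNA !addbF => g469.
have := @gauss_reciprocity A 469 A_odd isT coA.
by rewrite g469 addbF => ->; rewrite -[469./2]/(2 * 117) mulnCA mul2n odd_double.
Qed.

End ResidueCondition.

(** * Periodicity and the sieve on the index *)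

Definition pell_mod p j : nat * nat :=
  iter j (fun v => ((2 * v.1 + 5 * v.2) %% p, (v.1 + 2 * v.2) %% p)) (1 %% p, 0 %% p).

Lemma pell_modE p j : pell_mod p j = ((pell j).1 %% p, (pell j).2 %% p).
Proof.
elim: j => // j IH; rewrite /pell_mod iterS -/(pell_mod p j) IH /=.
by congr pair; apply/eqP; rewrite -modnDm ?modnMmr ?modnDm // modnDml.
Qed.

Lemma pell_mod_period p L j : pell_mod p L = (1 %% p, 0 %% p) ->
  pell_mod p j = pell_mod p (j %% L).
Proof.
move=> eL; rewrite {1}(divn_eq j L) addnC /pell_mod iterD -/(pell_mod p _).
congr iter; elim: (j %/ L) => // q IH.
by rewrite mulSn addnC /pell_mod iterD -/(pell_mod p L) eL.
Qed.

Lemma pell_sieve j z : z * z = 8 * (pell j).2 + 9 -> 56 %| j.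
Proof.
move=> ez; have j112 : j %% 112 < 112 by rewrite ltn_mod.
(* Modulo each of the six moduli the sequence repeats after 112 steps; every [r < 112] other than 0
   and 56 makes [8 M_r + 9] a nonsquare for one of them. *)
pose ok r := (56 %| r) || has (fun p =>
  let d := (8 * (pell_mod p r).2 + 9) %% p in all (fun x => (x * x) %% p != d) (iota 0 p))
  [:: 3; 13; 23; 29; 49; 83].
have /allP/(_ (j %% 112)) : all ok (iota 0 112) by vm_compute.
rewrite mem_iota j112 => /(_ isT) /orP[|/hasP[p pP /allP H]].
  by rewrite /dvdn modn_dvdm.
have p0 : 0 < p by move: pP; rewrite !inE; do ![case/orP|move/eqP->].
have per : pell_mod p 112 = (1 %% p, 0 %% p).
  by move: pP {H p0}; rewrite !inE; do ![case/orP|move/eqP->]; vm_compute.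
have := H (z %% p); rewrite mem_iota ltn_pmod // => /(_ isT) /eqP[].
rewrite modnMml modnMmr ez -(pell_mod_period _ per) pell_modE /=.
by apply/esym; rewrite -modnDml modnMmr modnDml.
Qed.

Lemma pell_odd j : (odd (pell j).1 = ~~ odd j) * (odd (pell j).2 = odd j).
Proof.
elim: j => // j [e1 e2] /=; rewrite 2!oddD 3!oddM /= e1 e2.
by case: (odd j).
Qed.

(** * Computing the symbol modulo 469 *)

(* The residues [a k] modulo [n] computed by successive additions, which keeps
   the unary numbers small when the symbol is evaluated. *)
Definition gauss_trace (a n : nat) : bool :=
  odd (count (fun r => n./2 < r) (traject (fun r => (r + a) %% n) (a %% n) n./2)).

Lemma gauss_traceE a n : gauss_trace a n = gauss a n.
Proof.
rewrite /gauss_trace /gauss; congr odd.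
rewrite -(count_map (fun k => (a * k) %% n) (fun r => n./2 < r)); congr count.
suff H m k : traject (fun r => (r + a) %% n) ((a * k) %% n) m
    = [seq (a * k) %% n | k <- iota k m] by rewrite -H muln1.
by elim: m k => //= m IH k; rewrite modnDml -mulnSr IH.
Qed.

(* [272] is the period of [pell] modulo [469]. *)
Definition nonresidue (pos : bool) l : bool :=
  let v := pell_mod 469 (l %% 272) in
  let a := (9 * v.1 + 8 * (if pos then v.2 else 469 - v.2)) %% 469 in
  coprime a 469 && gauss_trace a 469.

Lemma lin_comb_modD p Y M : (9 * (Y %% p) + 8 * (M %% p)) %% p = (9 * Y + 8 * M) %% p.
Proof. by rewrite -modnDm !modnMmr modnDm. Qed.

Lemma lin_comb_modB p Y M : 0 < p -> 8 * M <= 9 * Y ->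
  (9 * (Y %% p) + 8 * (p - M %% p)) %% p = (9 * Y - 8 * M) %% p.
Proof.
move=> p0 le89; apply/eqP; rewrite -(eqn_modDr (8 * M)) subnK //.
rewrite -modnDmr -(modnMmr 8 M) modnDmr -addnA -mulnDr subnK.
  by rewrite addnC modnMDl modnMmr.
by apply: ltnW; rewrite ltn_mod.
Qed.

(** * Identities for solutions of norm 1 *)

Section NormOne.
Variables Y M : nat.
Hypothesis norm : Y * Y = 5 * (M * M) + 1.

Lemma norm1_le : 2 * M <= Y.
Proof. by rewrite leqNgt; apply/negP => lt; have := leq_mul lt lt; lia. Qed.

Lemma norm1_le89 : 8 * M <= 9 * Y.
Proof. by have := norm1_le; lia. Qed.

Lemma norm1_odd_add : odd Y -> odd (9 * Y + 8 * M).
Proof. by move=> Y_odd; rewrite oddD 2!oddM Y_odd. Qed.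

Lemma norm1_odd_sub : odd Y -> odd (9 * Y - 8 * M).
Proof. by move=> Y_odd; rewrite (oddB norm1_le89) 2!oddM Y_odd. Qed.

(** Substituting [5 M^2 = Y^2 - 1] gives [5 (81 Y^2 - 64 M^2) = 341 Y^2 + 64], and
    [469 = 341 + 128]. *)
Lemma norm1_factor :
  469 * (Y * Y) = 64 * (2 * (Y * Y) - 1) + 5 * ((9 * Y + 8 * M) * (9 * Y - 8 * M)).
Proof.
have [B eB] : exists B, 9 * Y = 8 * M + B by exists (9 * Y - 8 * M); have := norm1_le; lia.
have e : 9 * Y * (9 * Y) = (8 * M + B) * (8 * M + B) by rewrite eB.
rewrite (_ : 9 * Y - 8 * M = B) ?eB ?addKn //; lia.
Qed.

Lemma norm1_square_add : 2 * (Y * (9 * Y + 8 * M)) = 9 * (2 * (Y * Y) - 1) + (8 * (2 * (Y * M)) + 9).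
Proof. by lia. Qed.

Lemma norm1_square_sub :
  2 * (Y * (9 * Y - 8 * M)) + 8 * (2 * (Y * M)) = 9 * (2 * (Y * Y) - 1) + 9.
Proof.
have [B eB] : exists B, 9 * Y = 8 * M + B by exists (9 * Y - 8 * M); have := norm1_le; lia.
have e : Y * (9 * Y) = Y * (8 * M + B) by rewrite eB.
by rewrite eB addKn; lia.
Qed.

End NormOne.

(** * Nonsquares among the numbers [8 M_j + 9] *)

Lemma pell_square_nonresidue (pos : bool) l q z : ~~ odd l ->
  z * z = 8 * (pell (2 * l * (4 * q + (if pos then 1 else 3)))).2 + 9 ->
  ~~ nonresidue pos l.
Proof.
move=> l_even ez; apply/negP => /andP[].
have per : pell_mod 469 272 = (1 %% 469, 0 %% 469) by vm_compute.
rewrite -(pell_mod_period l per) pell_modE /=.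
have norm := pell_norm l; rewrite (negPf l_even) in norm.
have M_even : ~~ odd (pell l).2 by rewrite pell_odd.
have Y_odd : odd (pell l).1 by rewrite pell_odd.
have k_even : ~~ odd (2 * l) by rewrite mul2n odd_double.
have ek : pell (2 * l) = (2 * ((pell l).1 * (pell l).1) - 1, 2 * ((pell l).1 * (pell l).2)).
  by rewrite mul2n -addnn pell_double.
have m1 := pell_mul1 q k_even; have m3 := pell_mul3 q k_even; rewrite ek /= in m1 m3.
move: (pell l) norm M_even Y_odd m1 m3 {ek} => [Y M] /= norm M_even Y_odd.
set N := 2 * (Y * Y) - 1 => m1 m3.
have le89 := norm1_le89 norm.
have odd_add := norm1_odd_add M Y_odd; have odd_sub := norm1_odd_sub norm Y_odd.
case: pos ez => ez.
  rewrite lin_comb_modD coprime_modl gauss_traceE gauss_modl => co.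
  have square : z * z = 2 * (Y * (9 * Y + 8 * M)) %[mod N].
    by rewrite ez (norm1_square_add norm) modnMDl -modnDml -modnMmr m1 modnMmr modnDml.
  by rewrite (gauss_469 M_even norm odd_add co (norm1_factor norm) square).
rewrite (@lin_comb_modB 469 Y M isT le89) coprime_modl gauss_traceE gauss_modl => co.
have eAB := norm1_factor norm; rewrite [_ * (_ - 8 * M)]mulnC in eAB.
have square : z * z = 2 * (Y * (9 * Y - 8 * M)) %[mod N].
  apply/eqP; rewrite -(eqn_modDr (8 * (2 * (Y * M)))) (norm1_square_sub norm) modnMDl ez.
  by rewrite addnAC -mulnDr -modnDml -modnMmr (eqP m3) muln0 mod0n add0n.
by rewrite (gauss_469 M_even norm odd_sub co eAB square).
Qed.

(* The powers of 2 have period 8 modulo 272 from [2 ^ 4] on, which leaves a finite check. *)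
Lemma nonresidue_pow2 e pos : 1 < e -> nonresidue (~~ pos) (2 ^ e) || nonresidue pos (7 * 2 ^ e).
Proof.
elim/ltn_ind: e => e IH e2; have [e12|e12] := ltnP e 12.
  have : all (fun e => all (fun b => nonresidue (~~ b) (2 ^ e) || nonresidue b (7 * 2 ^ e))
     [:: true; false]) (iota 2 10) by vm_compute.
  move=> /allP/(_ e); rewrite mem_iota e2 => /(_ e12) /allP; apply.
  by case: (pos).
have [f ef] : exists f, e = f + 12 by exists (e - 12); lia.
have e8 : 2 ^ e = 2 ^ (f + 4) %[mod 272].
  (* Here [272 = 16 * 17], and [2 ^ 8] is 1 modulo 17. *)
  by rewrite ef !expnD -modnMmr (_ : 2 ^ 12 %% 272 = 2 ^ 4).
have -> b : nonresidue b (2 ^ e) = nonresidue b (2 ^ (f + 4)) by rewrite /nonresidue e8.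
have -> b : nonresidue b (7 * 2 ^ e) = nonresidue b (7 * 2 ^ (f + 4)).
  by rewrite /nonresidue -modnMmr e8 modnMmr.
by apply: IH; lia.
Qed.

Lemma pell_not_square j z : 0 < j -> z * z <> 8 * (pell j).2 + 9.
Proof.
move=> j0 ez; have j56 := pell_sieve ez.
have [//|u u_odd ej] := @pfactor_coprime 2 j _ j0; rewrite coprime2n in u_odd.
have v3 : 2 < logn 2 j.
  by rewrite -(@pfactor_dvdn 2 3) //; apply: dvdn_trans j56.
have /dvdnP[w eu] : 7 %| u.
  have : 7 %| u * 2 ^ logn 2 j by rewrite -ej; apply: dvdn_trans j56.
  by rewrite Gauss_dvdl // coprimeXr.
(* One factor 2 of [j] is set aside for [j = 2 l t]; divisibility by 8 leaves [e >= 2]. *)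
have [e ee] : exists e, logn 2 j = e.+1 by exists (logn 2 j).-1; lia.
rewrite ee in ej v3.
have w_odd : odd w by move: u_odd; rewrite eu oddM andbT.
have pow_even : ~~ odd (2 ^ e) by rewrite oddX; lia.
(* [j = 2 l t] with [t] odd for both [l = 2 ^ e], [t = 7 w] and [l = 7 * 2 ^ e], [t = w];
   these two values of [t] are in opposite classes modulo 4. *)
have [pos [q ew]] : exists pos : bool, exists q, w = 4 * q + (if pos then 1 else 3).
  have [->|->] : w = 4 * (w %/ 4) + 1 \/ w = 4 * (w %/ 4) + 3 by lia.
    by exists true; exists (w %/ 4).
  by exists false; exists (w %/ 4).
have [q' eu'] : exists q', u = 4 * q' + (if ~~ pos then 1 else 3).
  by rewrite eu ew; case: (pos); [exists (7 * q + 1)|exists (7 * q + 5)]; rewrite /=; lia.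
have /orP[] := nonresidue_pow2 pos v3; apply/negP.
  apply: (@pell_square_nonresidue _ _ q' z) => //.
  by rewrite ez -eu' ej expnS [u * _]mulnC.
apply: (@pell_square_nonresidue _ _ q z); first by rewrite oddM (negPf pow_even).
by rewrite ez -ew ej eu expnS; congr (8 * (pell _).2 + 9); lia.
Qed.

Lemma unit_not_square Y M z : 0 < M ->
  Y * Y = 5 * (M * M) + 1 \/ Y * Y + 1 = 5 * (M * M) -> z * z <> 8 * M + 9.
Proof.
move=> M0 /pell_complete[[|j] ej] ez; first by case: ej => _ eM; rewrite -eM in M0.
by apply: (@pell_not_square j.+1 z); rewrite // ej.
Qed.

(** * Integer points on the curve *)

Import Order.TTheory GRing.Theory Num.Theory.
Local Open Scope ring_scope.

Lemma signz (n : int) : (-1) ^ n = (if (2 %| n)%Z then 1 else -1) :> int.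
Proof.
have -> : (2 %| n)%Z = ~~ odd `|n|%N by rewrite dvdzE dvdn2.
have e m : (-1) ^+ m = (if ~~ odd m then 1 else -1) :> int by rewrite -signr_odd; case: odd.
case: n => m; first by rewrite -exprnP e.
by rewrite NegzE -exprnN e abszN; case: odd.
Qed.

Lemma curve_range (x y s : int) : s = 1 \/ s = -1 ->
  y ^+ 2 = 5 * x ^+ 2 * (x + 3) ^+ 2 + 4 * s -> -3 <= x <= 0.
Proof.
move=> sP; rewrite !expr2 => e.
have [M eM] : exists M, x * (x + 3) = 2 * M.
  have : (x = 2 * (x %/ 2)%Z \/ x = 2 * (x %/ 2)%Z + 1) by lia.
  move: (x %/ 2)%Z => k [->|->]; [exists (k * (2 * k + 3))|exists ((2 * k + 1) * (k + 2))]; ring.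
have ey : y * y = 4 * (5 * (M * M) + s).
  rewrite e (_ : 5 * (x * x) * ((x + 3) * (x + 3)) = 5 * ((x * (x + 3)) * (x * (x + 3)))); last by ring.
  by rewrite eM; ring.
have [Y eY] : exists Y, y = 2 * Y.
  have : (y = 2 * (y %/ 2)%Z \/ y = 2 * (y %/ 2)%Z + 1) by lia.
  move: (y %/ 2)%Z => k [->|ek]; [by exists k|].
  by move: ey; rewrite ek => ey; exfalso; lia.
have [M0|M0] := lerP M 0; first by nia.
have eYM : Y * Y = 5 * (M * M) + s by rewrite eY in ey; lia.
have ez : (2 * x + 3) * (2 * x + 3) = 8 * M + 9 by lia.
exfalso; apply: (@unit_not_square (absz Y) (absz M) (absz (2 * x + 3)%R) _ _ _).
- by lia.
- by move: sP => [es|es]; [left|right]; rewrite es in eYM; nia.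
- by move: (2 * x + 3) ez => z ez; nia.
Qed.

Theorem theorem2 (n x y : int)
    (hxy : y ^+ 2 = 5 * x ^+ 2 * (x + 3) ^+ 2 + 4 * (-1) ^ n) :
  ((2 %| n)%Z ->
     (x, y) \in [:: (-3, 2); (-3, -2); (0, 2); (0, -2)]) /\
  (~~ (2 %| n)%Z ->
     (x, y) \in [:: (-2, 4); (-2, -4); (-1, 4); (-1, -4)]).
Proof.
rewrite signz in hxy; rewrite !inE !xpair_eqE.
have sP (b : bool) : (if b then 1 else -1) = 1 :> int \/ (if b then 1 else -1) = -1 :> int.
  by case: b; [left|right].
have := curve_range (sP _) hxy; rewrite !expr2 in hxy.
have xP : -3 <= x <= 0 -> [\/ x = -3, x = -2, x = -1 | x = 0].
  by move=> ?; have : x = -3 \/ x = -2 \/ x = -1 \/ x = 0 by [lia]; case=> [|[|[|]]] ->; constructor.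
have sq a : y * y = a * a -> y = a \/ y = - a.
  by move/eqP; rewrite -!expr2 eqf_sqr => /orP[]/eqP; [left|right].
(* At [x = -3, 0] the equation reads [y^2 = 4] or [-4], and at [x = -2, -1] it reads [y^2 = 24] or
   [16], for [n] even or odd respectively. *)
have not24 : y * y <> 24.
  move=> e24; have /andP[y0 y1] : -4 <= y <= 4 by nia.
  have : y = -4 \/ y = -3 \/ y = -2 \/ y = -1 \/ y = 0 \/ y = 1 \/ y = 2 \/ y = 3 \/ y = 4 by lia.
  by intuition (subst y; lia).
have neg : y * y <> -4 by nia.
case: (2 %| n)%Z in hxy *; move=> /xP x_cases; split=> // _;
  case: x_cases hxy => -> hxy;
  try by [case: neg; lia | case: not24; lia].
- by have [] := sq 2 ltac:(lia); lia.
- by have [] := sq 2 ltac:(lia); lia.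
- by have [] := sq 4 ltac:(lia); lia.
- by have [] := sq 4 ltac:(lia); lia.
Qed.
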